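(* Let $G$ be a $3$-regular connected graph with $n = |V(G)| \geq 8$ vertices. Then $G$ has a spanning $\left\lfloor \frac{2n+4}{9} \right\rfloor$-ended tree, i.e. a spanning tree with at most $\left\lfloor \frac{2n+4}{9} \right\rfloor$ leaves.
   Context: All graphs are finite, undirected, without loops or multiple edges. A graph is $3$-regular if every vertex has degree $3$. For a positive integer $k$, a tree $T$ is called a $k$-ended tree if the number of its end-vertices (vertices of degree one, i.e. leaves) is at most $k$. *)

(* Defs.v *)
From mathcomp Require Import all_boot.
Set Implicit Arguments. Unset Strict Implicit. Unset Printing Implicit Defensive.

Definition symmetric_rel (T : finType) (e : rel T) : Prop :=
  forall x y, e x y = e y x.
Definition irreflexive_rel (T : finType) (e : rel T) : Prop :=
  forall x, e x x = false.

Definition simple_graph (T : finType) (e : rel T) : Prop :=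
  symmetric_rel e /\ irreflexive_rel e.

Definition deg (T : finType) (e : rel T) (x : T) : nat := #|[set y | e x y]|.

Definition regular3 (T : finType) (e : rel T) : Prop := forall x, deg e x = 3.

Definition connected (T : finType) (e : rel T) : Prop :=
  forall x y, connect e x y.

Definition has_cycle (T : finType) (e : rel T) : Prop :=
  exists c : seq T, [/\ 3 <= size c, uniq c & cycle e c].

Definition spanning_tree (T : finType) (e t : rel T) : Prop :=
  [/\ simple_graph t, subrel t e, connected t & ~ has_cycle t].

Definition leaves (T : finType) (t : rel T) : {set T} :=
  [set x | deg t x == 1].

Definition k_ended (T : finType) (t : rel T) (k : nat) : Prop :=
  #|leaves t| <= k.

(* Main.v *)
Require Import Defs.
From mathcomp Require Import all_boot zify.

(** Among the connected spanning subgraphs take a tree [t] with fewest edges and then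
    fewest leaves, and suppose it has L >= 3 leaves.  Replacing a tree edge cd by an edge
    xy of the graph that reconnects the two sides never lowers the number of leaves, so
    the leaves are independent, and every nontree neighbour of a leaf has degree 2 in [t],
    hence only one nontree edge.  This gives 2L vertices of degree 2; call the other ones
    free.  An exchange along the path from a leaf x towards a nontree neighbour turns a
    vertex v of that path into a leaf of another optimal tree, and the independence of the
    leaves of that tree shows that v is free.  Each free vertex is obtained from at most two
    leaves, so there are at least L/2 free vertices; as t has at least L - 2 vertices of
    degree 3, n >= L + 2L + L/2 + (L - 2). *)

Set Implicit Arguments. Unset Strict Implicit. Unset Printing Implicit Defensive.

(** * Counting and connectivity for a relation *)

Section Relations.
Variable T : finType.
Implicit Types (t : rel T) (S : {set T}).

Lemma card_set_sum (P : pred T) : #|[set v | P v]| = \sum_v P v.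
Proof. by rewrite -sum1dep_card big_mkcond; apply: eq_bigr => v _; case: (P v). Qed.

Lemma card_sum1 : #|T| = \sum_(v : T) 1.
Proof. by rewrite -cardsT -sum1_card; apply: eq_bigl => v; rewrite inE. Qed.

Lemma degE t v : deg t v = \sum_w t v w.
Proof. by rewrite /deg card_set_sum. Qed.

Lemma sum_eq1 (a : T) : \sum_w (w == a : nat) = 1.
Proof. by rewrite (bigD1 a) //= eqxx big1 // => w /negbTE->. Qed.

Lemma card_replace1 S x v : x \in S -> #|v |: (S :\ x)| <= #|S|.
Proof. by move=> xS; rewrite cardsU1 (cardsD1 x S) xS leq_add2r; case: (v \notin _). Qed.

Lemma card_replace2 S x y v : x \in S -> y \in S -> x != y -> #|v |: (S :\ x :\ y)| < #|S|.
Proof.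
move=> xS yS xy; rewrite (cardsD1 x S) xS ltnS; apply: card_replace1.
by rewrite !inE eq_sym xy.
Qed.

Lemma connect_step_out t S x y :
  connect t x y -> x \in S -> y \notin S -> exists u v, [/\ u \in S, v \notin S & t u v].
Proof.
case/connectP=> p; elim: p x => [|z p IHp] x /= => [_ -> -> //|].
case/andP=> txz tp yE xS yNS; have [zS|zNS] := boolP (z \in S); first exact: IHp tp yE zS yNS.
by exists x, z.
Qed.

Lemma connect_in_closed t S x y :
  (forall u v, u \in S -> t u v -> v \in S) -> x \in S -> connect t x y -> y \in S.
Proof.
move=> clS xS cxy; apply/negPn/negP => yNS.
have [u [v [uS vNS tuv]]] := connect_step_out cxy xS yNS.
by rewrite (clS u v) in vNS.
Qed.

(** Turns a degree bound into a case analysis: once [s] holds as many neighbours as the degree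
    allows, no other is left. *)
Lemma nbrs_in t v (s : seq T) w :
  uniq s -> all (t v) s -> deg t v <= size s -> t v w -> w \in s.
Proof.
move=> us ts ds tvw; have sub : [set y in s] \subset [set y | t v y].
  by apply/subsetP => y; rewrite !inE; apply: (allP ts).
have: [set y in s] == [set y | t v y].
  by rewrite eqEcard sub (_ : #|[set y in s]| = size s) // cardsE; apply/card_uniqP.
by move/eqP/setP/(_ w); rewrite !inE tvw.
Qed.

Definition darts t := \sum_v deg t v.

(** Grow a vertex set one vertex at a time along an edge leaving it; every new vertex brings at
    least two darts. The [+ 2] pays for the first vertex. *)
Lemma connected_darts t :
  symmetric_rel t -> connected t -> 0 < #|T| -> 2 * #|T| <= darts t + 2.
Proof.
move=> st ct T0.
have grow k : 0 < k -> k <= #|T| -> exists2 S : {set T}, #|S| = k &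
    2 * k <= \sum_(u in S) \sum_(v in S) t u v + 2.
  elim: k => // k IHk _ kT; case: (posnP k) => [->|k0].
    have [x _] := card_gt0P T0; exists [set x]; first by rewrite cards1.
    by rewrite leq_addl.
  have [S Sk Sd] := IHk k0 (ltnW kT).
  have /card_gt0P[x xS] : 0 < #|S| by rewrite Sk.
  have /card_gt0P[y] : 0 < #|~: S| by rewrite cardsCs setCK Sk subn_gt0.
  rewrite inE => yS; have [u [v [uS vS tuv]]] := connect_step_out (ct x y) xS yS.
  exists (v |: S); first by rewrite cardsU1 vS Sk.
  rewrite big_setU1 //= big_setU1 //=.
  have -> : \sum_(i in S) \sum_(j in v |: S) t i j =
      \sum_(i in S) t i v + \sum_(i in S) \sum_(j in S) t i j.
    by rewrite -big_split; apply: eq_bigr => i _; rewrite big_setU1.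
  have : 0 < \sum_(i in S) t i v by rewrite (bigD1 u) //= tuv.
  have -> : \sum_(j in S) t v j = \sum_(i in S) t i v by apply: eq_bigr => i _; rewrite st.
  lia.
have [S ST] := grow _ T0 (leqnn _); have -> : S = setT.
  by apply/eqP; rewrite eqEcard subsetT cardsT ST leqnn.
move=> H; apply: leq_trans H _; rewrite leq_add2r /darts.
under [X in _ <= X]eq_bigr => v _ do rewrite degE.
under eq_bigl => v do rewrite inE.
by under eq_bigr => v _ do under eq_bigl => w do rewrite inE.
Qed.

(** * Deleting and adding an edge *)

Definition edge (c d : T) : rel T := fun u v => (u == c) && (v == d) || (u == d) && (v == c).
Definition del t c d : rel T := fun u v => t u v && ~~ edge c d u v.
Definition add t c d : rel T := fun u v => t u v || edge c d u v.

Lemma edge_sym c d : symmetric_rel (edge c d).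
Proof. by move=> u v; rewrite /edge orbC ![(v == _) && _]andbC. Qed.

Lemma del_sym t c d : symmetric_rel t -> symmetric_rel (del t c d).
Proof. by move=> st u v; rewrite /del edge_sym st. Qed.

Lemma add_sym t c d : symmetric_rel t -> symmetric_rel (add t c d).
Proof. by move=> st u v; rewrite /add edge_sym st. Qed.

Lemma sum_edge c d v : c != d -> \sum_w (edge c d v w : nat) = (v == c) + (v == d).
Proof.
move=> cd; rewrite -[in RHS](muln1 (v == c)) -[in RHS](muln1 (v == d)).
rewrite -{1}(sum_eq1 d) -(sum_eq1 c) !big_distrr -big_split /=; apply: eq_bigr => w _.
rewrite /edge; case: (v =P c) => [->|]; rewrite ?(negbTE cd) ?orbF //=; first by rewrite addn0 mul1n.
by case: (v == d) => /=; rewrite ?mul1n ?mul0n.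
Qed.

Lemma deg_del t c d v : symmetric_rel t -> t c d -> c != d ->
  deg (del t c d) v + ((v == c) + (v == d)) = deg t v.
Proof.
move=> st tcd cd; rewrite -sum_edge // !degE -big_split; apply: eq_bigr => w _ /=.
rewrite /del /edge; case: (v =P c) => [->|_] /=.
  by case: (w =P d) => [->|_] /=; rewrite ?tcd ?(negbTE cd) ?andbT ?addn0.
by case: (v =P d) => [->|_] /=; case: (w =P c) => [->|_] /=; rewrite ?(st d c) ?tcd ?andbT ?addn0.
Qed.

Lemma deg_add t c d v : symmetric_rel t -> ~~ t c d -> c != d ->
  deg (add t c d) v = deg t v + ((v == c) + (v == d)).
Proof.
move=> st tcd cd; rewrite -sum_edge // !degE -big_split; apply: eq_bigr => w _ /=.
rewrite /add /edge; case: (v =P c) => [->|_] /=.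
  by case: (w =P d) => [->|_] /=; rewrite ?(negbTE tcd) ?(negbTE cd) ?orbF ?addn0.
by case: (v =P d) => [->|_] /=; case: (w =P c) => [->|_] /=; rewrite ?(st d c) ?(negbTE tcd) ?orbF ?addn0.
Qed.

(* A repetition-free path through the edge cd does not return to it. *)
Lemma connect_del_path t x p1 d p2 (c := last x p1) :
    path t x (p1 ++ d :: p2) -> uniq (x :: p1 ++ d :: p2) ->
  connect (del t c d) x c /\ connect (del t c d) d (last d p2).
Proof.
rewrite cat_path -cat_cons cat_uniq => /andP[tp1] /andP[_ tp2] /and3P[_ N _].
have cp : c \in x :: p1 by apply: mem_last.
split; apply/connectP.
  exists p1 => //; apply: (sub_in_path (P := predC1 d)) tp1.
    by move=> u v; rewrite /del /edge !inE => /negbTE-> /negbTE->; rewrite !andbF andbT.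
  apply/allP => u up /=; apply: contraNneq N => <-; apply/hasP; exists u => //.
  exact: mem_head.
exists p2 => //; apply: (sub_in_path (P := predC1 c)) tp2.
  by move=> u v; rewrite /del /edge !inE => /negbTE-> /negbTE->; rewrite !andbF andbT.
by apply/allP => u up /=; apply: contraNneq N => uc; apply/hasP; exists u => //; rewrite /= uc.
Qed.

Lemma connect_uniq_path t x y : connect t x y ->
  exists p, [/\ path t x p, last x p = y & uniq (x :: p)].
Proof. by case/connectP=> p tp ->; case: (shortenP tp) => q tq uq _; exists q. Qed.

(** Without its edge [xy], the rest of a cycle still joins [x] and [y], so an edge of a cycle is
    never a bridge. *)
Lemma bridges_acyclic t : symmetric_rel t ->
  (forall c d, t c d -> ~~ connect (del t c d) c d) -> ~ has_cycle t.
Proof.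
move=> st br [[|x [|y [|z r]]] [] //= _ uc /and3P[txy tyz]].
apply/negP; rewrite rcons_path; set l := last z r; apply/negP => /andP[tr tlx].
have sd : connect_sym (del t x y) by apply: sym_connect_sym; apply: del_sym.
case/negP: (br _ _ txy); rewrite sd; apply: (@connect_trans _ _ l); last first.
  apply: connect1; rewrite /del tlx /edge eqxx andbT /=.
  move: uc => /andP[xN /andP[yN _]]; rewrite negb_or; apply/andP; split.
    apply/negP => /andP[_ xy]; by rewrite -(eqP xy) mem_head in xN.
  by apply: contraNneq yN => <-; rewrite mem_last.
apply/connectP; exists (z :: r) => //; apply: (@sub_in_path _ (predC1 x) t) => [u v||].
- by rewrite /del /edge !inE => /negbTE-> /negbTE->; rewrite andbF andbT.
- case/andP: uc => xN _; apply/allP => u up /=; apply: contraNneq xN => <-; exact: up.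
- by rewrite /= tyz.
Qed.

End Relations.

(** * Optimal subgraphs and edge exchange *)

Section Optimal.
Variables (T : finType) (e : rel T).
Hypotheses (sg : simple_graph e) (reg : regular3 e) (ce : connected e) (T8 : 8 <= #|T|).
Implicit Types (t : rel T).

Let e_sym : symmetric_rel e := sg.1.
Let e_irr : irreflexive_rel e := sg.2.

Definition conn_sub t := [/\ symmetric_rel t, subrel t e & connected t].

(* Every vertex set has size at most #|T|, so this orders lexicographically by
   (number of edges, number of leaves). *)
Definition weight t := darts t * #|T|.+1 + #|leaves t|.

Definition optimal t := conn_sub t /\ forall t', conn_sub t' -> weight t <= weight t'.

(** Relations recovered from sets of pairs agree with the original ones only pointwise. *)
Lemma eq_weight t t' : t =2 t' -> weight t = weight t'.
Proof.
move=> tt'; have dd v : deg t v = deg t' v by rewrite !degE; apply: eq_bigr => w _; rewrite tt'.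
rewrite /weight /darts (eq_bigr _ (fun v _ => dd v)); congr (_ + _).
by apply: eq_card => v; rewrite !inE dd.
Qed.

Lemma optimal_exists : exists t, optimal t.
Proof.
(* Relations are coded as sets of pairs, so that the minimum is taken over a finite type. *)
pose rl (A : {set T * T}) : rel T := fun u v => (u, v) \in A.
pose P A := [&& [forall x, forall y, rl A x y == rl A y x],
  [forall x, forall y, rl A x y ==> e x y] & [forall x, forall y, connect (rl A) x y]].
have PP A : reflect (conn_sub (rl A)) (P A).
  apply: (iffP and3P) => [[/forallP s /forallP u /forallP c]|[s u c]].
    split=> x y; [exact/eqP/(forallP (s x))|exact/implyP/(forallP (u x))|exact/(forallP (c x))].
  split; apply/forallP => x; apply/forallP => y; [exact/eqP|exact/implyP/u|exact: c].
pose st t := [set p | t p.1 p.2].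
have stE t : rl (st t) =2 t by move=> u v; rewrite /rl inE.
have Pst t : conn_sub t -> P (st t).
  case=> s u c; apply/PP; split=> x y; first by rewrite !stE s.
    by rewrite stE; apply: u.
  by rewrite (eq_connect (stE t)).
have e_ok : conn_sub e by split.
case: (@arg_minnP _ (st e) P (fun A => weight (rl A)) (Pst e e_ok)) => A /PP PA minA.
exists (rl A); split=> // t' /Pst/minA; by rewrite (eq_weight (stE t')).
Qed.

Lemma leaves_lt_card t : #|leaves t| < #|T|.+1.
Proof. by rewrite ltnS max_card. Qed.

Lemma conn_sub_irr t x : conn_sub t -> t x x = false.
Proof. by case=> _ te _; apply/negP => /te; rewrite e_irr. Qed.

Lemma conn_sub_neq t x y : conn_sub t -> t x y -> x != y.
Proof. by move=> ct txy; apply: contraTneq txy => ->; rewrite conn_sub_irr. Qed.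

Lemma darts_del t c d : conn_sub t -> t c d -> darts (del t c d) + 2 = darts t.
Proof.
move=> ct tcd; have cd := conn_sub_neq ct tcd; case: ct => st _ _.
rewrite /darts -(eq_bigr _ (fun v _ => deg_del v st tcd cd)) big_split /=; congr (_ + _).
by rewrite big_split /= !sum_eq1.
Qed.

(** Deleting an edge that is not a bridge keeps the graph connected and saves two darts; the factor
    [#|T|.+1] in [weight] makes this outweigh any change in the number of leaves. *)
Lemma optimal_bridge t c d : optimal t -> t c d -> ~~ connect (del t c d) c d.
Proof.
move=> [ct opt] tcd; apply/negP => ccd.
have dd := darts_del ct tcd; have [st te cct] := ct.
have cd : conn_sub (del t c d).
  split; [exact: del_sym | by move=> u v /andP[/te] |].
  move=> u v; apply: (connect_sub _ (cct u v)) => {u v} u v tuv.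
  have [|euv] := boolP (edge c d u v); last by apply: connect1; rewrite /del tuv.
  case/orP=> /andP[/eqP-> /eqP->] //.
  by rewrite (sym_connect_sym (del_sym c d st)).
have := opt _ cd; rewrite /weight -dd.
have := leaves_lt_card (del t c d); nia.
Qed.

Lemma optimal_tree t : optimal t -> spanning_tree e t.
Proof.
move=> ot; have [ct _] := ot; have [st te cct] := ct; split=> //.
  by split=> // x; apply: conn_sub_irr.
by apply: bridges_acyclic => // c d; apply: optimal_bridge.
Qed.

Definition swap t c d x y := add (del t c d) x y.

(** The edge [xy] rejoins the two sides of the bridge [cd] and the number of edges is unchanged, so
    optimality compares leaf counts alone. The degree identity avoids truncated subtraction. *)
Lemma swap_optimal t c d x y (t' := swap t c d x y) :
    optimal t -> t c d -> connect (del t c d) c x -> connect (del t c d) d y -> e x y ->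
  [/\ forall w, deg t' w + ((w == c) + (w == d)) = deg t w + ((w == x) + (w == y)),
      #|leaves t| <= #|leaves t'| & #|leaves t'| <= #|leaves t| -> optimal t'].
Proof.
move=> ot tcd cx dy exy; have [ct opt] := ot; have [st te cct] := ct.
have sd := del_sym c d st; have csd := sym_connect_sym sd.
have xy : x != y by apply: contraTneq exy => ->; rewrite e_irr.
have nxy : ~~ del t c d x y.
  apply: contra (optimal_bridge ot tcd) => /connect1 xyc.
  by apply: connect_trans cx (connect_trans xyc _); rewrite csd.
have sub : subrel (connect (del t c d)) (connect t').
  by apply: connect_sub => u v duv; apply: connect1; rewrite /t' /swap /add duv.
have st' : symmetric_rel t' by apply: add_sym.
have cs : conn_sub t'.
  split=> //.
    move=> u v /orP[/andP[/te]|] //.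
    by case/orP=> /andP[/eqP-> /eqP->] //; rewrite e_sym.
  have ccd : connect t' c d.
    apply: connect_trans (sub _ _ cx) _; rewrite (sym_connect_sym st') .
    apply: connect_trans (sub _ _ dy) _; rewrite (sym_connect_sym st').
    by apply: connect1; rewrite /t' /swap /add /edge !eqxx orbT.
  move=> u v; apply: (connect_sub _ (cct u v)) => {u v} u v tuv.
  have [|euv] := boolP (edge c d u v); last by apply/sub/connect1; rewrite /del tuv.
  by case/orP=> /andP[/eqP-> /eqP->] //; rewrite (sym_connect_sym st').
have degs w : deg t' w + ((w == c) + (w == d)) = deg t w + ((w == x) + (w == y)).
  by rewrite deg_add // addnAC deg_del //; apply: conn_sub_neq tcd.
have dt : darts t' = darts t.
  apply/eqP; rewrite -(eqn_add2r 2) /darts; apply/eqP.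
  have : \sum_w (deg t' w + ((w == c) + (w == d))) = \sum_w (deg t w + ((w == x) + (w == y))).
    by apply: eq_bigr.
  by rewrite !big_split /= !sum_eq1.
have lt := opt _ cs; rewrite /weight dt leq_add2l in lt.
split=> // lt'; split=> // t'' /opt; apply: leq_trans.
by rewrite /weight dt leq_add2l.
Qed.

(** * Degrees and independence of the leaves *)

Section Degrees.
Variable t : rel T.
Hypothesis ot : optimal t.

Let ct : conn_sub t := ot.1.
Let t_sym : symmetric_rel t. Proof. by case: ct. Qed.
Let t_e : subrel t e. Proof. by case: ct. Qed.
Let t_con : connected t. Proof. by case: ct. Qed.

Lemma deg_nontree v : deg t v + #|[set w | e v w && ~~ t v w]| = 3.
Proof.
have e3 : #|[set w | e v w]| = 3 by apply: reg.
rewrite -[RHS]e3 -[RHS](cardsID [set w | t v w]); congr (_ + _); apply: eq_card => w.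
  by rewrite !inE andbC; case tvw: (t v w) => //=; rewrite t_e.
by rewrite !inE andbC.
Qed.

Lemma deg_le3 v : deg t v <= 3.
Proof. by rewrite -(deg_nontree v) leq_addr. Qed.

Lemma deg_gt0 v : 0 < deg t v.
Proof.
have /card_gt0P[w] : 0 < #|[set~ v]| by rewrite cardsC1; lia.
rewrite !inE => wv; have /connectP[[|u p] /=] := t_con v w; first by move=> _ wE; rewrite wE eqxx in wv.
by case/andP=> tvu _ _; apply/card_gt0P; exists u; rewrite inE.
Qed.

Lemma card_by_degree :
  #|T| = #|leaves t| + #|[set v | deg t v == 2]| + #|[set v | deg t v == 3]|.
Proof.
rewrite card_sum1 /leaves !card_set_sum -!big_split; apply: eq_bigr => v _ /=.
by move: (deg_gt0 v) (deg_le3 v); case: (deg t v) => [|[|[|[|]]]].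
Qed.

(** As degrees are 1, 2 or 3, their sum is 2n minus the number of leaves plus the number of vertices
    of degree 3; connectedness makes it at least 2n - 2. *)
Lemma leaves_le_branching : #|leaves t| <= #|[set v | deg t v == 3]| + 2.
Proof.
have := connected_darts t_sym t_con; have -> : 0 < #|T| by lia.
move/(_ isT); have : darts t + #|leaves t| = 2 * #|T| + #|[set v | deg t v == 3]|.
  rewrite card_sum1 /leaves !card_set_sum big_distrr /darts -!big_split /=.
  by apply: eq_bigr => v _ /=; move: (deg_gt0 v) (deg_le3 v); case: (deg t v) => [|[|[|[|]]]].
lia.
Qed.

Hypothesis L3 : 2 < #|leaves t|.

Definition unbranched : rel T := fun u v => [&& t u v, deg t u < 3 & deg t v < 3].

(* Otherwise the path would exhaust the tree. *)
Lemma leaves_not_unbranched x y :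
  x \in leaves t -> y \in leaves t -> x != y -> ~~ connect unbranched x y.
Proof.
rewrite !inE => /eqP dx /eqP dy xy; apply/negP => /connect_uniq_path[p [up py uq]].
have tp : path t x p by apply: sub_path up => u v /and3P[].
have d2 v : v \in x :: p -> deg t v < 3.
  rewrite inE => /predU1P[->|vp]; first by rewrite dx.
  by case/splitPr: vp up => p1 p2; rewrite cat_path /= => /and3P[_ /and3P[]].
(* A path through all vertices excludes degree 3, which leaves at most two leaves. *)
suff all_in v : v \in x :: p.
  have := leaves_le_branching; rewrite (_ : [set v | _] = set0) ?cards0; first by lia.
  by apply/setP => v; rewrite !inE; have := d2 v (all_in v); case: eqP => // ->.
suff: v \in [set z in x :: p] by rewrite inE.
(* The path is closed under adjacency: an end has its only neighbour on it, an inner vertex [u] has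
   only its path neighbours [l] and [h]. *)
apply: connect_in_closed (t_con x v) => [{v} u w|]; last by rewrite inE mem_head.
rewrite !inE => /predU1P[->|].
  case: p tp py {up uq d2} => [|h p] /=; first by move=> _ xyE; rewrite xyE eqxx in xy.
  case/andP=> txh _ _ txw; have := @nbrs_in _ t x [:: h] w isT.
  by rewrite /= txh dx txw !inE => /(_ isT isT isT) /eqP->; rewrite eqxx orbT.
move=> up'; case/splitPr: up' tp py uq d2 {up} => p1 p2.
rewrite cat_path /=; set l := last x p1 => /and3P[_ tlu tp2].
have lp : l \in x :: p1 by apply: mem_last.
case: p2 tp2 => [_|h p2 /=].
  rewrite last_cat /= => uy _ _ tuw; have := @nbrs_in _ t u [:: l] w isT.
  rewrite /= t_sym tlu uy dy -uy tuw !inE => /(_ isT isT isT) /eqP->.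
  by move: lp; rewrite inE mem_cat => /predU1P[->|->]; rewrite ?eqxx ?orbT.
case/andP=> tuh _ _ uq d2 tuw.
have lh : l != h.
  move: uq; rewrite -[_ && _]/(uniq ((x :: p1) ++ u :: h :: p2)) cat_uniq => /and3P[_ N _]; apply: contra N => /eqP lh.
  by apply/hasP; exists h; rewrite ?inE ?eqxx ?orbT // -lh -in_cons.
have := @nbrs_in _ t u [:: l; h] w; rewrite /= inE lh t_sym tlu tuh tuw -ltnS.
rewrite d2 ?inE ?mem_cat ?mem_head ?orbT // => /(_ isT isT isT isT) /orP[/eqP->|].
  by move: lp; rewrite inE => /predU1P[->|->]; rewrite ?eqxx ?orbT.
by rewrite inE => /eqP->; rewrite !inE eqxx !orbT.
Qed.

(** The tree path from [x] to [y] contains a vertex [c] of degree 3. Exchanging the edge [cd] that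
    follows it for [xy] leaves [c] with degree 2, so every leaf of the new tree other than [d] is an
    old leaf different from [x] and [y]: the number of leaves drops. *)
Lemma leaves_independent x y : x \in leaves t -> y \in leaves t -> ~~ e x y.
Proof.
move=> xL yL; apply/negP => exy; have xy : x != y by apply: contraTneq exy => ->; rewrite e_irr.
move: (xL) (yL); rewrite !inE => /eqP dx /eqP dy.
have [p [tp py up]] := connect_uniq_path (t_con x y).
have /allPn[c] : ~~ all (fun v => deg t v < 3) (x :: p).
  apply: contra (leaves_not_unbranched xL yL xy) => dp; apply/connectP; exists p => //.
  by apply: (sub_in_path _ dp tp) => u v /= du dv tuv; apply/and3P.
rewrite -leqNgt inE => /predU1P[-> | cp dc]; first by rewrite dx.
have d3 : deg t c = 3 by apply/eqP; rewrite eqn_leq deg_le3.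
case/splitPr: cp tp py up => p1 [|d p2]; first by rewrite last_cat /= => _ cy; rewrite cy dy in d3.
rewrite -cat_rcons => tp; rewrite last_cat /= => py up.
have := connect_del_path tp up; rewrite last_rcons py => -[xc dy'].
have tcd : t c d by move: tp; rewrite cat_path last_rcons /= => /and3P[].
have cx : connect (del t c d) c x by rewrite (sym_connect_sym (del_sym c d t_sym)).
have [degs le _] := swap_optimal ot tcd cx dy' exy.
have xc' : x != c by apply: contraTneq isT => xc'; rewrite xc' d3 in dx.
have yc' : y != c by apply: contraTneq isT => yc'; rewrite yc' d3 in dy.
suff sub : leaves (swap t c d x y) \subset d |: (leaves t :\ x :\ y).
  have := leq_trans le (subset_leq_card sub).
  by rewrite leqNgt (card_replace2 d xL yL xy).
apply/subsetP => w; rewrite !inE => /eqP w1; have := degs w; rewrite w1.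
have [//|wd] := eqVneq w d; have [->|wx] := eqVneq w x; first by rewrite (negbTE xc') dx.
have [->|wy] := eqVneq w y; first by rewrite (negbTE yc') dy.
have [->|wc] := eqVneq w c; first by rewrite d3.
by rewrite /= !addn0 => <-.
Qed.

End Degrees.

(** * Charging leaves to free vertices *)

Variable t : rel T.
Hypotheses (ot : optimal t) (L3 : 2 < #|leaves t|).

Let ct : conn_sub t := ot.1.
Let t_sym : symmetric_rel t. Proof. by case: ct. Qed.
Let t_e : subrel t e. Proof. by case: ct. Qed.
Let t_con : connected t. Proof. by case: ct. Qed.

(** After the exchange [x] is no leaf and [u] keeps degree at least 2, so only [v] can be a new
    leaf. Optimality forces it to be one: [v] had degree 2, the new tree is again optimal, and its
    leaves, [v] and the old ones except [x], are independent. The pair [(u, v)] allows [v] on either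
    side of the cut. *)
Lemma swap_at_leaf c d x y u v :
    t c d -> connect (del t c d) c x -> connect (del t c d) d y -> e x y -> x \in leaves t ->
    (u, v) = (c, d) \/ (u, v) = (d, c) -> deg t u = 3 \/ u = y -> v != x ->
  [/\ deg t v = 2, v != y & forall z, z \in leaves t -> z != x -> ~~ e v z].
Proof.
move=> tcd cx dy exy xL uv uy vx; have xy : x != y by apply: contraTneq exy => ->; rewrite e_irr.
have [degs le opt'] := swap_optimal ot tcd cx dy exy.
have cd := conn_sub_neq ct tcd.
have {degs} degs w : deg (swap t c d x y) w + ((w == u) + (w == v)) = deg t w + ((w == x) + (w == y)).
  by rewrite -degs; case: uv => -[-> ->] //; rewrite [(w == d) + _]addnC.
have uv' : u != v by case: uv => -[-> ->] //; rewrite eq_sym.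
have dx : deg t x = 1 by move: xL; rewrite inE => /eqP.
have dy1 : deg t y <> 1.
  by move=> dy1; have := leaves_independent ot L3 xL; move/(_ y); rewrite inE dy1 exy => /(_ isT).
have dy0 := deg_gt0 ot y.
have xu : x != u by case: uy => [du|->] //; apply: contraTneq isT => xu; rewrite -xu dx in du.
have sub : leaves (swap t c d x y) \subset v |: (leaves t :\ x).
  apply/subsetP => w; rewrite !inE => /eqP w1; have := degs w; rewrite w1.
  have [//|wv] := eqVneq w v; have [->|wx] := eqVneq w x; first by rewrite (negbTE xu) dx.
  have [->|wy] := eqVneq w y; first by move: dy0 dy1; case: (y == u); move: (deg t y); clear; lia.
  have [wu|wu] := eqVneq w u; first by case: uy => [du|uy]; [rewrite wu du => /eqP|rewrite -uy wu eqxx in wy].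
  by rewrite /= !addn0 => <-.
have cL : #|v |: (leaves t :\ x)| <= #|leaves t| by apply: card_replace1.
have eqL : leaves (swap t c d x y) = v |: (leaves t :\ x).
  by apply/eqP; rewrite eqEcard sub (leq_trans cL).
have vL : v \in leaves (swap t c d x y) by rewrite eqL setU11.
have dv := degs v; move: (vL); rewrite inE => /eqP v1.
rewrite v1 eqxx (negbTE vx) eq_sym (negbTE uv') in dv.
have vy : v != y by apply/eqP => vy; case: dy1; move: dv; rewrite vy eqxx; clear; lia.
rewrite (negbTE vy) in dv; split=> // [|z zL zx]; first by move: dv; clear; lia.
have o' := opt' (leq_trans (subset_leq_card sub) cL).
apply: (leaves_independent o') => //; first exact: leq_trans L3 le.
by rewrite eqL in_setU1 in_setD1 zx zL orbT.
Qed.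

Definition free v := (deg t v == 2) && [forall z in leaves t, e v z ==> t v z].

Lemma freeP v :
  reflect (deg t v = 2 /\ forall z, z \in leaves t -> e v z -> t v z) (free v).
Proof.
apply: (iffP andP) => [[/eqP-> /forall_inP F]|[-> F]]; split=> //.
  by move=> z /F /implyP.
by apply/forall_inP => z /F zF; apply/implyP.
Qed.

(* The leaf x is charged to the free vertex v; the anchor a is the neighbour of v
   on the side of x, and y lies beyond v. *)
Definition charge x v a y :=
  [/\ x \in leaves t, free v, t a v, e x y & ~~ t x y] /\
  [/\ connect (del t a v) v y &
      t x a /\ deg t a = 3 \/ connect (unbranched t) x v /\ deg t a < 3].

(** Follow the tree path from [x] through its neighbour [b] to a nontree neighbour [y]. If [b] has
    degree 3, [v] is the vertex after [b] and [bv] is removed. Otherwise let [d] be the first vertex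
    after [x] that has degree 3 or is a nontree neighbour of [x]; [v] is the vertex before [d] and
    [vd] is removed. *)
Lemma charge_exists x : x \in leaves t -> exists v a y, charge x v a y.
Proof.
move=> xL; have dx : deg t x = 1 by move: xL; rewrite inE => /eqP.
have /card_gt0P[y] : 0 < #|[set w | e x w && ~~ t x w]| by have := deg_nontree ot x; rewrite dx; clear; lia.
rewrite inE => /andP[exy txy]; have [p [tp py up]] := connect_uniq_path (t_con x y).
case: p tp py up => [_ /= xyE|b p tp py up]; first by rewrite -xyE e_irr in exy.
have txb : t x b by case/andP: tp.
have [d3|d3] := eqVneq (deg t b) 3.
  case: p tp py up => [_ /= byE|v p tp py up]; first by rewrite -byE txb in txy.
  rewrite -cat1s in tp up; have := connect_del_path tp up; rewrite /= in py; rewrite py /=.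
  case=> xb vy; have bx : connect (del t b v) b x by rewrite (sym_connect_sym (del_sym b v t_sym)).
  have tbv : t b v by case/and3P: tp.
  have vx : v != x by move: up; rewrite /= !inE !negb_or [x == v]eq_sym => /andP[/and3P[]].
  have [d2 _ vN] := swap_at_leaf tbv bx vy exy xL (or_introl erefl) (or_introl d3) vx.
  exists v, b, y; do 2!split=> //; last by left.
  apply/freeP; split=> // z zL evz; have [zx|zx] := eqVneq z x; last by case/negP: (vN z zL zx).
  rewrite zx in evz *; rewrite e_sym in evz.
  (* With [v] itself in the role of [y], the conclusion [v != y] is absurd. *)
  have [_] := swap_at_leaf tbv bx (connect0 _ v) evz xL (or_introl erefl) (or_introl d3) vx.
  by rewrite eqxx.
pose Q d := (deg t d == 3) || e x d && ~~ t x d.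
have hQ : has Q (b :: p).
  by apply/hasP; exists y; [rewrite -py; exact: (mem_last b p)|rewrite /Q exy txy orbT].
have Qd3 d : ~~ Q d -> deg t d < 3.
  by rewrite negb_or ltn_neqAle => /andP[-> _]; exact: deg_le3.
(* As [b] fails [Q], some vertex [v] other than [x] precedes the first one satisfying [Q]. *)
have Qb : ~~ Q (head x (b :: p)) by rewrite /Q /= (negbTE d3) txb andbF.
move: hQ Qb tp py up; move: (b :: p) => q hQ.
case: (split_find hQ) => d s1 s2 Qd; case/lastP: s1 => [|s0 v] NQ; first by rewrite /= Qd.
move=> _ tp py up {q hQ}; set a := last x s0.
have := tp; rewrite cat_rcons cat_path => /andP[ts1 /=]; rewrite last_rcons => /andP[tvd _].
have tav : t a v by move: ts1; rewrite rcons_path => /andP[].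
have Qv : ~~ Q v by move: NQ; rewrite -all_predC all_rcons => /andP[].
have tp1 : path t x (rcons s0 v ++ d :: s2) by rewrite -cat_rcons.
have up1 : uniq (x :: rcons s0 v ++ d :: s2) by rewrite -cat_rcons.
have tp0 : path t x (s0 ++ v :: d :: s2) by rewrite -[s0 ++ _]cat_rcons.
have up0 : uniq (x :: s0 ++ v :: d :: s2) by rewrite -[s0 ++ _]cat_rcons.
have vx : v != x.
  by move: up0 => /andP[+ _]; rewrite mem_cat !inE !negb_or [x == v]eq_sym => /and3P[].
have lz : last d s2 = y by move: py; rewrite last_cat last_rcons.
have [_ /= avy] := connect_del_path tp0 up0.
have := connect_del_path tp1 up1; rewrite last_rcons lz => -[xv dy].
have vx' : connect (del t v d) v x by rewrite (sym_connect_sym (del_sym v d t_sym)).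
have low u : u \in x :: rcons s0 v -> deg t u < 3.
  rewrite inE => /predU1P[->|us]; first by rewrite dx.
  by apply: Qd3; move: NQ; rewrite -all_predC => /allP/(_ u us).
have [d2 vN] : deg t v = 2 /\ forall z, z \in leaves t -> z != x -> ~~ e v z.
  case/orP: Qd => [/eqP dd3|/andP[exd _]].
    by have [-> _ vN] := swap_at_leaf tvd vx' dy exy xL (or_intror erefl) (or_introl dd3) vx.
  (* Here the added edge is [xd], so [d] keeps its degree. *)
  by have [-> _ vN] := swap_at_leaf tvd vx' (connect0 _ d) exd xL (or_intror erefl) (or_intror erefl) vx.
exists v, a, y; split; split=> //.
- apply/freeP; split=> // z zL evz; have [zx|zx] := eqVneq z x; last by case/negP: (vN z zL zx).
  rewrite zx in evz *; move: Qv; rewrite negb_or e_sym evz /= negbK => /andP[_].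
  by rewrite t_sym.
- by rewrite -lz.
right; split; last by apply: low; rewrite /a -cats1 -cat_cons mem_cat mem_last.
apply/connectP; exists (rcons s0 v); last by rewrite last_rcons.
apply: (@sub_in_path _ (fun u => deg t u < 3) t) ts1; last exact/allP.
by move=> u w /= du dw tuw; apply/and3P.
Qed.

(** The degree of [a] decides between the alternatives of [charge]. If it is below 3, unbranched
    paths join [x1] to [x2] through [v]. Otherwise the neighbours of [a] are [x1], [x2] and [v], so
    [a3] differs from [a], and no place is left for [y3]. *)
Lemma charge_same_anchor x1 x2 x3 v a a3 y1 y2 y3 :
    charge x1 v a y1 -> charge x2 v a y2 -> charge x3 v a3 y3 ->
  x1 != x2 -> x2 != x3 -> x3 != x1 -> False.
Proof.
have unb_sym : connect_sym (unbranched t).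
  by apply: sym_connect_sym => u w; rewrite /unbranched t_sym; case: (t w u); rewrite //= andbC.
move=> [[x1L /freeP[dv vN] tav _ _] [_ c1]] [[x2L _ _ _ _] [_ c2]].
move=> [[x3L _ ta3v e3 t3] [cy3 c3]] x12 x23 x31.
case: c1 c2 => [[tx1 da]|[u1 da]] [[tx2 da']|[u2 da']]; [|by rewrite da in da'|by rewrite da' in da|]; last first.
  case/negP: (leaves_not_unbranched ot L3 x1L x2L x12).
  by apply: connect_trans u1 _; rewrite unb_sym.
have dL x : x \in leaves t -> deg t x = 1 by rewrite inE => /eqP.
have xv x : x \in leaves t -> x != v.
  by move=> /dL xL; apply: contraTneq isT => xv; rewrite xv dv in xL.
have aN w : t a w -> w \in [:: x1; x2; v].
  apply: nbrs_in; last by rewrite da.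
    by rewrite /= !inE !negb_or x12 !xv.
  by rewrite /= !(t_sym a) tx1 tx2 t_sym tav.
have [a3a|a3a] := eqVneq a3 a.
  rewrite a3a in c3; case: c3 => [[tx3 _]|[_]]; last by rewrite da.
  move: (aN x3); rewrite t_sym tx3 => /(_ isT); rewrite !inE (negbTE x31).
  by rewrite eq_sym (negbTE x23) (negbTE (xv _ x3L)).
have lN x w : x \in leaves t -> t x a -> t x w -> w = a.
  move=> xL txa txw; have := @nbrs_in _ t x [:: a] w isT.
  by rewrite /= txa dL // inE => /(_ isT isT txw)/eqP.
have vNb w : t v w -> w \in [:: a; a3].
  by apply: nbrs_in; rewrite /= ?dv // ?inE 1?eq_sym ?a3a // !(t_sym v) tav ta3v.
(* Once the edge between [a3] and [v] is deleted, nothing else is reachable from [v]. *)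
have : y3 \in [set v; a; x1; x2].
  apply: connect_in_closed cy3 => [u w|]; last by rewrite !inE eqxx.
  rewrite !inE -!orbA => /or4P[] /eqP-> /andP[tuw euw].
  - move: (vNb _ tuw); rewrite !inE => /orP[->|wa3]; rewrite ?orbT //.
    by move: euw; rewrite /edge eqxx wa3 !andbT orbT.
  - by have := aN _ tuw; rewrite !inE => /or3P[]->; rewrite ?orbT.
  - by rewrite (lN _ _ x1L tx1 tuw) eqxx orbT.
  - by rewrite (lN _ _ x2L tx2 tuw) eqxx orbT.
(* In turn: [v] is free, [a] has no nontree edge, and the leaves [x1] and [x2] are not adjacent to
   the leaf [x3]. *)
rewrite !inE -!orbA => /or4P[] /eqP yE; rewrite yE in e3 t3.
- by move: t3; rewrite t_sym vN // e_sym.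
- have := deg_nontree ot a; have /card_gt0P : exists w, w \in [set w | e a w && ~~ t a w].
    by exists x3; rewrite inE e_sym e3 t_sym.
  by rewrite da; clear; lia.
- by case/negP: (leaves_independent ot L3 x3L x1L).
- by case/negP: (leaves_independent ot L3 x3L x2L).
Qed.

(** Since [v] has degree 2, two of the three anchors coincide. *)
Lemma charge_le2 x1 x2 x3 v a1 a2 a3 y1 y2 y3 :
    charge x1 v a1 y1 -> charge x2 v a2 y2 -> charge x3 v a3 y3 ->
  x1 != x2 -> x2 != x3 -> x3 != x1 -> False.
Proof.
move=> c1 c2 c3 x12 x23 x31.
have [a12|a12] := eqVneq a1 a2.
  by rewrite a12 in c1; apply: charge_same_anchor c1 c2 c3 _ _ _.
have : a3 \in [:: a1; a2].
  case: c1 c2 c3 => [[_ /freeP[dv _] t1 _ _] _] [[_ _ t2 _ _] _] [[_ _ t3 _ _] _].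
  by apply: (@nbrs_in _ t v); rewrite ?dv //= ?inE ?a12 // !(t_sym v) ?t1 ?t2.
rewrite !inE => /orP[] /eqP aE; rewrite aE in c3.
  exact: charge_same_anchor c3 c1 c2 x31 x12 x23.
exact: charge_same_anchor c2 c3 c1 x23 x31 x12.
Qed.

(** * The final count *)

Lemma leaves_le_free : #|leaves t| <= 2 * #|[set v | free v]|.
Proof.
have [f fP] : exists f : T -> T, forall x, x \in leaves t -> exists a y, charge x (f x) a y.
  apply: (@fin_all_exists T (fun=> T)
    (fun x v => x \in leaves t -> exists a y, charge x v a y)) => x.
  case: (boolP (x \in leaves t)) => [/charge_exists[v cv]|_].
    by exists v.
  by exists x.
rewrite -sum1_card (partition_big f (mem [set v | free v])) /=; last first.
  by move=> x /fP[a [y [[_ fx _ _ _] _]]]; rewrite inE.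
rewrite mulnC -sum_nat_const; apply: leq_sum => v _.
rewrite sum1dep_card leqNgt; apply/card_gt2P => -[x1 [x2 [x3 [[]]]]].
move=> /setIdP[/fP[a1 [y1 c1]] /eqP f1] /setIdP[/fP[a2 [y2 c2]] /eqP f2].
move=> /setIdP[/fP[a3 [y3 c3]] /eqP f3] [x12 x23 x31].
rewrite f1 in c1; rewrite f2 in c2; rewrite f3 in c3.
exact: charge_le2 c1 c2 c3 x12 x23 x31.
Qed.

(** Count the nontree edges at leaves, two for each leaf, by their other ends. Such an end is no
    leaf by independence, so it has degree 2, just one nontree edge, and is not free. *)
Lemma deg2_ge : 2 * #|leaves t| + #|[set v | free v]| <= #|[set v | deg t v == 2]|.
Proof.
have -> : 2 * #|leaves t| = \sum_(x in leaves t) \sum_v (e x v && ~~ t x v).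
  rewrite mulnC -sum_nat_const; apply: eq_bigr => x; rewrite inE => /eqP dx.
  by rewrite -card_set_sum; have := deg_nontree ot x; rewrite dx; clear; lia.
rewrite exchange_big /= !card_set_sum -big_split; apply: leq_sum => v _ /=.
have [/existsP[x /and3P[xL exv txv]]|] := boolP [exists x, [&& x \in leaves t, e x v & ~~ t x v]].
  have nv : x \in [set w | e v w && ~~ t v w] by rewrite inE e_sym exv t_sym.
  have -> : free v = false.
    by apply/freeP => -[_ /(_ x xL)]; rewrite e_sym t_sym (negbTE txv) => /(_ exv).
  have d2 : deg t v = 2.
    have := deg_nontree ot v; have := deg_gt0 ot v.
    have : deg t v <> 1.
      by move=> d1; have := leaves_independent ot L3 xL; move/(_ v); rewrite inE d1 exv => /(_ isT).
    by rewrite (cardD1 x) nv; clear; lia.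
  rewrite d2 addn0 /=; have <- : #|[set w | e v w && ~~ t v w]| = 1.
    by have := deg_nontree ot v; rewrite d2; clear; lia.
  rewrite big_mkcond card_set_sum; apply: leq_sum => w _; case: (w \in _) => //.
  by rewrite e_sym t_sym.
rewrite negb_exists => /forallP N; rewrite big1 => [|x xL]; first by rewrite /free; case: eqP => //; case: forallP.
by have := N x; rewrite xL /= => /negbTE->.
Qed.

Lemma leaves_bound : 9 * #|leaves t| <= 2 * #|T| + 4.
Proof.
have := leaves_le_free; have := deg2_ge; have := leaves_le_branching ot.
by rewrite (card_by_degree ot); clear; lia.
Qed.

End Optimal.

Theorem mainTheorem3 (T : finType) (e : rel T) :
  simple_graph e -> regular3 e -> connected e -> 8 <= #|T| ->
  exists t : rel T, spanning_tree e t /\ k_ended t ((2 * #|T| + 4) %/ 9).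
Proof.
move=> sg reg ce T8; have [t ot] := optimal_exists sg ce.
exists t; split; first exact: optimal_tree ot.
rewrite /k_ended leq_divRL // mulnC.
(* For at most two leaves, 18 <= 2n + 4 follows from n >= 8. *)
have [L2|L3] := leqP #|leaves t| 2; first by lia.
exact: leaves_bound ot L3.
Qed.
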